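(* Let $M\in\mathbb{N}$, $\mathcal{I}=\{1,\dots,M\}$, let $\{A_1,\dots,A_M\}\subset\mathbb{R}^{n\times n}$, $\rho>0$ and $\tau_2\ge\tau_1\ge0$. Suppose there exist symmetric positive definite matrices $P_1^+,P_1^-,\dots,P_M^+,P_M^-\succ0$ in $\mathbb{R}^{n\times n}$ such that $$e^{A_i^\top t}P_i^+e^{A_it}\preceq e^{-2\rho t}P_i^-\quad\forall i\in\mathcal{I},\ \forall t\in[0,\tau_2-\tau_1],$$ $$e^{A_i^\top\tau_1}P_j^-e^{A_i\tau_1}\preceq e^{-2\rho\tau_1}P_i^+\quad\forall i,j\in\mathcal{I}\text{ with }i\ne j.$$ Then the switched linear system $\dot x(t)=A_{\sigma(t)}x(t)$ is $\rho$-UES on $\mathcal{S}_{\mathrm{dw}}(\tau_1,\tau_2)$.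
   Context: $\mathbb{R}_+=[0,\infty)$. $\preceq$ and $\succ$ denote the usual (Loewner) order on symmetric matrices. $\mathcal{S}$ is the set of piecewise constant, right-continuous signals $\sigma:\mathbb{R}_+\to\mathcal{I}$. For $\sigma\in\mathcal{S}$, set $t_0^\sigma=0$ and let $t_1^\sigma<t_2^\sigma<\cdots$ be the positive times at which $\sigma$ is discontinuous (switching instants); if there are infinitely many, they are unbounded. $\mathcal{S}_{\mathrm{dw}}(\tau_1,\tau_2)$ is the set of $\sigma\in\mathcal{S}$ having infinitely many switching instants and satisfying $\tau_1\le t_k^\sigma-t_{k-1}^\sigma\le\tau_2$ for all $k\ge1$. $\Phi_\sigma(t,x)$ denotes the solution at time $t\ge0$ of $\dot x(t)=A_{\sigma(t)}x(t)$ with initial condition $x\in\mathbb{R}^n$ at time $0$. For $\rho>0$, the system is uniformly exponentially stable with decay $\rho$ on $\widetilde{\mathcal{S}}\subseteq\mathcal{S}$ ($\rho$-UES) if there is $C\ge0$ such that $|\Phi_\sigma(t,x)|\le Ce^{-\rho t}|x|$ for all $\sigma\in\widetilde{\mathcal{S}}$, $x\in\mathbb{R}^n$, $t\in\mathbb{R}_+$. *)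

(* Defs.v *)
From HB Require Import structures.
From mathcomp Require Import all_boot all_order all_algebra.
From mathcomp Require Import all_classical all_reals all_analysis.

Set Implicit Arguments.
Unset Strict Implicit.
Unset Printing Implicit Defensive.

Import Order.TTheory GRing.Theory Num.Theory.
Import numFieldNormedType.Exports.

Local Open Scope classical_set_scope.
Local Open Scope ring_scope.

Section matrices.
Context {R : realType} {n : nat}.
Implicit Types (A B P : 'M[R]_n) (x : 'cV[R]_n).

Definition expmx A : 'M[R]_n :=
  lim (series (fun k : nat => (k`!%:R)^-1 *: A ^+ k) @ \oo).

Definition psdmx P := P^T = P /\ forall x, 0 <= (x^T *m P *m x) 0 0.

Definition posdefmx P :=
  P^T = P /\ forall x, x != 0 -> 0 < (x^T *m P *m x) 0 0.

Definition loewner_le A B := psdmx (B - A).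

(* The library norm on matrices is the sup norm. *)
Definition enorm x : R := Num.sqrt (\sum_(i < n) x i 0 ^+ 2).

End matrices.

Section signals.
Context {R : realType} {M : nat}.

(* A signal on R_+ is a total function on R of which only the values at
   nonnegative times are ever used. *)
Implicit Types sigma : R -> 'I_M.

(* 'I_M is discrete, so continuity at t means being constant near t. *)
Definition switching_instant sigma (t : R) :=
  0 < t /\ ~ (\forall s \near t, sigma s = sigma t).

(* Finitely many discontinuities in bounded time: between two consecutive ones
   sigma is locally constant, hence constant. *)
Definition signals : set (R -> 'I_M) :=
  [set sigma |
    (forall T : R, finite_set [set t | switching_instant sigma t /\ t <= T]) /\
    (forall t : R, 0 <= t -> \forall s \near t^'+, sigma s = sigma t)].

(* The existence of the strictly increasing enumeration t_1 < t_2 < ... of all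
   switching instants says that there are infinitely many of them. *)
Definition dwell_signals (tau1 tau2 : R) : set (R -> 'I_M) :=
  [set sigma | signals sigma /\
    exists t : nat -> R,
      [/\ t 0%N = 0,
          (forall k, t k < t k.+1),
          [set t k.+1 | k in [set: nat]] = [set s | switching_instant sigma s] &
          forall k, tau1 <= t k.+1 - t k <= tau2]].

End signals.

Section switched_system.
Context {R : realType} {n M : nat}.
Variable A : 'I_M -> 'M[R]_n.

(* phi is t |-> Phi_sigma(t, x): continuous on R_+, and satisfying the equation
   at every positive time that is not a switching instant. *)
Definition is_solution (sigma : R -> 'I_M) (x : 'cV[R]_n)
    (phi : R -> 'cV[R]_n) :=
  [/\ phi 0 = x,
      {within `[0, +oo[, continuous phi} &
      forall t : R, 0 < t -> ~ switching_instant sigma t ->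
        is_derive t 1 phi (A (sigma t) *m phi t)].

Definition UES (rho : R) (S : set (R -> 'I_M)) :=
  exists2 C : R, 0 <= C &
    forall sigma, S sigma ->
    forall (x : 'cV[R]_n) (phi : R -> 'cV[R]_n), is_solution sigma x phi ->
    forall t : R, 0 <= t -> enorm (phi t) <= C * expR (- rho * t) * enorm x.

End switched_system.

(* Main.v *)
Require Import Defs.
From HB Require Import structures.
From mathcomp Require Import all_boot all_order all_algebra.
From mathcomp Require Import all_classical all_reals all_analysis.
From mathcomp Require Import ring lra.

Set Implicit Arguments.
Unset Strict Implicit.
Unset Printing Implicit Defensive.

Import Order.TTheory GRing.Theory Num.Theory.
Import numFieldNormedType.Exports.

Local Open Scope classical_set_scope.
Local Open Scope ring_scope.

(** Between two switching instants the mode is some [i], and the trajectory is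
    propagated by the exponential of [A i].  Cut an interval of duration in
    [tau1, tau2] into a first piece of length at most [tau2 - tau1] and a last
    piece of length exactly [tau1].  On the first piece the flow inequality
    turns the quadratic form [Pm i] into [Pp i], on the last piece the jump
    inequality turns [Pp i] into [Pm j], where [j] is the next mode; it applies
    because a switch does change the mode ([switching_neq]).  Each piece
    multiplies the form by the decay factor of its own length, so the quadratic
    form of [Pm] in the current mode, sampled at the switching instants,
    telescopes to an exponential decay of rate [2 * rho]
    ([lyapunov_period]).

    The finitely many forms [Pm i] are uniformly equivalent to the squared
    Euclidean norm ([posdef_coercive], [qform_le_enorm]), which turns this into
    a decay of rate [rho] of the norm at switching instants.  These are
    unbounded, as only finitely many of them lie in bounded time, so every time
    [s] lies less than [tau2] after one of them; since the growth
    over such a delay is at most a constant ([norm_expmx_le]), the bound extends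
    to all times.

    The analytic ingredient is that every solution of the equation
    [phi' = A *m phi] on a segment is given by the exponential series
    ([flow_expmx]).  It is obtained without differentiating the exponential:
    the sums of [(b - t)^j / j! * A^j *m phi t] over [j < k] interpolate between
    the partial sum of the series at [t = a] and [phi b] at [t = b], and their
    derivative collapses to a single term, which tends to 0 with [k]. *)

(** * Entrywise convergence of matrices *)

Lemma cvg_mx_entries (R : realFieldType) m n (T : Type) (F : set_system T)
    {FF : ProperFilter F} (u : T -> 'M[R]_(m, n)) (l : 'M[R]_(m, n)) :
  (forall i j, u x i j @[x --> F] --> l i j) -> u x @[x --> F] --> l.
Proof.
move=> ul; apply/cvgrPdist_le => e e0; near=> x.
rewrite /Num.Def.normr/= mx_normrE (bigmax_le _ (ltW e0))//= => i _.
rewrite !mxE; move: i; near: x; apply: filter_forall => i.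
exact: ((cvgrPdist_le _ _).1 (ul i.1 i.2)).
Unshelve. all: by end_near. Qed.

Lemma cvg_mx_entry (R : realFieldType) m n (T : Type) (F : set_system T)
    {FF : Filter F} (u : T -> 'M[R]_(m, n)) (l : 'M[R]_(m, n)) i j :
  u x @[x --> F] --> l -> u x i j @[x --> F] --> l i j.
Proof. by move=> ul; exact: (continuous_cvg _ (@coord_continuous R m n i j l)). Qed.

Lemma cvg_mulmx (R : realFieldType) m n p (T : Type) (F : set_system T)
    {FF : ProperFilter F} (u : T -> 'M[R]_(m, n)) (v : T -> 'M[R]_(n, p))
    (l : 'M[R]_(m, n)) (r : 'M[R]_(n, p)) :
  u x @[x --> F] --> l -> v x @[x --> F] --> r ->
  (u x *m v x) @[x --> F] --> l *m r.
Proof.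
move=> ul vr; apply: cvg_mx_entries => i j; rewrite mxE.
under eq_fun do rewrite mxE.
apply: cvg_big => [|k _]; first exact: add_continuous.
by apply: cvgM; exact: cvg_mx_entry.
Qed.

Lemma norm_mx_entry_le (R : realFieldType) m n (B : 'M[R]_(m, n)) i j :
  `|B i j| <= `|B|.
Proof.
rewrite [leRHS]/Num.Def.normr/= mx_normrE.
exact: (le_bigmax _ (fun ij => `|B ij.1 ij.2|) (i, j)).
Qed.

(** * The matrix exponential *)

Section matrix_exponential.
Context {R : realType} {n : nat}.
Implicit Types A B : 'M[R]_n.

(** The library norm of a matrix is the largest modulus of its entries, which is
    not submultiplicative; multiplied by the size, it bounds the operator norm
    for the sup norm on columns. *)
Definition mxrate A : R := n%:R * `|A|.

Lemma mxrate_ge0 A : 0 <= mxrate A.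
Proof. by rewrite mulr_ge0. Qed.

Lemma mxrateZ A (s : R) : 0 <= s -> mxrate (s *: A) = s * mxrate A.
Proof. by move=> s0; rewrite /mxrate mx_normZ (ger0_norm s0) mulrCA. Qed.

Lemma norm_mulmx_le p A (B : 'M[R]_(n, p)) (c : R) i j :
  (forall l, `|B l j| <= c) -> `|(A *m B) i j| <= mxrate A * c.
Proof.
move=> Bc; rewrite mxE (le_trans (ler_norm_sum _ _ _))//.
have -> : mxrate A * c = \sum_(l < n) `|A| * c.
  by rewrite sumr_const card_ord /mxrate -mulrA mulr_natl.
by apply: ler_sum => l _; rewrite normrM ler_pM// norm_mx_entry_le.
Qed.

Lemma norm_mxpow_mulmx_le p A (B : 'M[R]_(n, p)) (c : R) k i j :
  (forall l, `|B l j| <= c) -> `|(A ^+ k *m B) i j| <= mxrate A ^+ k * c.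
Proof.
move=> Bc; elim: k i => [|k IH] i; first by rewrite expr0 mul1mx mul1r.
by rewrite !exprS -mulmxE -mulmxA -mulrA norm_mulmx_le.
Qed.

Lemma norm_mxpow_le A k i j : `|(A ^+ k) i j| <= mxrate A ^+ k.
Proof.
rewrite -[A ^+ k]mulmx1 -[leRHS]mulr1; apply: norm_mxpow_mulmx_le => l.
by rewrite mxE; case: eqP; rewrite ?normr1 ?normr0 ?ler01.
Qed.

Definition exp_term A k : 'M[R]_n := k`!%:R^-1 *: A ^+ k.

Lemma norm_exp_term_le A k i j :
  `|exp_term A k i j| <= exp_coeff (mxrate A) k.
Proof.
rewrite /exp_term mxE normrM ger0_norm ?invr_ge0// mulrC.
by rewrite /exp_coeff/= ler_wpM2r ?invr_ge0// norm_mxpow_le.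
Qed.

Lemma series_mxE (u : nat -> 'M[R]_n) k i j :
  series u k i j = series (fun l => u l i j) k.
Proof. by rewrite /series/= summxE. Qed.

Lemma is_cvg_normed_series_exp_term A i j : cvgn [normed series (fun k => exp_term A k i j)].
Proof.
apply: (@series_le_cvg _ _ (exp_coeff (mxrate A))) => //=.
- by move=> k; rewrite mulr_ge0 ?invr_ge0 ?exprn_ge0 ?mxrate_ge0.
- by move=> k; exact: norm_exp_term_le.
- exact: is_cvg_series_exp_coeff.
Qed.

(** [expmx] is a limit operator, meaningless unless the series converges; each
    entry is dominated by the scalar exponential series of [mxrate A]. *)
Lemma cvg_expmx A : series (exp_term A) @ \oo --> expmx A.
Proof.
suff : cvgn (series (exp_term A)) by [].
apply/cvg_ex; exists (\matrix_(i, j) limn (series (fun k => exp_term A k i j))).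
apply: cvg_mx_entries => i j; rewrite mxE.
under eq_fun do rewrite series_mxE.
by apply: normed_cvg; exact: is_cvg_normed_series_exp_term.
Qed.

Lemma norm_expmx_le A i j : `|expmx A i j| <= expR (mxrate A).
Proof.
have cA : `|series (exp_term A) k i j| @[k --> \oo] --> `|expmx A i j|.
  by apply: cvg_norm; apply: cvg_mx_entry; exact: cvg_expmx.
rewrite -(cvg_lim _ cA)//; apply: limr_le; first by apply/cvg_ex; exists `|expmx A i j|.
near=> k; rewrite series_mxE (le_trans (ler_norm_sum _ _ _))//.
apply: (@le_trans _ _ (series (exp_coeff (mxrate A)) k)).
  by apply: ler_sum => l _; exact: norm_exp_term_le.
apply: nondecreasing_cvgn_le; last exact: is_cvg_series_exp_coeff.
by apply: nondecreasing_series => l _ _; rewrite /= mulr_ge0 ?invr_ge0 ?exprn_ge0 ?mxrate_ge0.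
Unshelve. all: by end_near. Qed.

Lemma trmx_exp A k : (A ^+ k)^T = A^T ^+ k.
Proof.
by elim: k => [|k IH]; [rewrite !expr0 trmx1 | rewrite exprS exprSr -!mulmxE trmx_mul IH].
Qed.

Lemma expmx_tr A : expmx A^T = (expmx A)^T.
Proof.
apply: (@cvg_lim _ _ _ \oo) => //; apply: cvg_mx_entries => i j; rewrite mxE.
rewrite (_ : (fun k => _) = (fun k => series (exp_term A) k j i)).
  by apply: cvg_mx_entry; exact: cvg_expmx.
apply/funext => k; rewrite !series_mxE; apply: eq_bigr => l _.
by rewrite !mxE -trmx_exp mxE.
Qed.

End matrix_exponential.

(** * Linear differential equations with constant coefficients *)

Section linear_flow.
Context {R : realType} {n : nat}.
Variables (A : 'M[R]_n) (phi : R -> 'cV[R]_n) (a b : R).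

Let y k (i : 'I_n) (t : R) : R := (A ^+ k *m phi t) i 0.

(** The [k]-term Taylor expansion at [t] predicting the value at [b] of a
    solution of the equation. *)
Let psi k i (t : R) : R := \sum_(j < k) (j`!%:R^-1 * (b - t) ^+ j) * y j i t.

Let is_derive_y (t : R) k i : is_derive t 1 phi (A *m phi t) ->
  is_derive t 1 (y k i) (y k.+1 i t).
Proof.
move=> [dphi phiE].
have dentry l : is_derive t 1 (fun s => phi s l 0) ((A *m phi t) l 0).
  split; first by move/derivable_mxP : dphi.
  by rewrite -phiE derive_mx// mxE.
have -> : y k i = \sum_(l < n) ((A ^+ k) i l \*o (fun s => phi s l 0)).
  by apply/funext => s; rewrite fct_sumE /y mxE.
have -> : y k.+1 i t = \sum_(l < n) (A ^+ k) i l * (A *m phi t) l 0.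
  by rewrite /y exprSr -mulmxE -mulmxA mxE.
exact: is_derive_sum.
Qed.

Let is_derive_weight (t : R) k :
  is_derive t 1 (fun s => k.+1`!%:R^-1 * (b - s) ^+ k.+1 : R)
                (- (k`!%:R^-1 * (b - t) ^+ k)).
Proof.
have d1 : is_derive t 1 ((cst b - id) : R -> R) (- 1).
  by apply: is_derive_eq; rewrite sub0r.
have d2 := @is_deriveX _ _ (cst b - id : R -> R) k.+1 t 1 (-1) d1.
have d3 := is_deriveM (is_derive_cst (k.+1`!%:R^-1 : R) t 1) d2.
rewrite (_ : (fun s => _) = cst k.+1`!%:R^-1 * (cst b - id : R -> R) ^+ k.+1);
  last by apply/funext => s; rewrite !fctE.
apply: (is_derive_eq d3).
rewrite scaler0 addr0 /= /GRing.scale/= factS natrM.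
by field; rewrite pnatr_eq0 -lt0n fact_gt0 addrC natr1 pnatr_eq0.
Qed.

(** When [phi] solves the equation at [t], the derivative of the weight of one
    term cancels the derivative of [phi] in the preceding term. *)
Let is_derive_psi (t : R) k i : is_derive t 1 phi (A *m phi t) ->
  is_derive t 1 (psi k.+1 i) (k`!%:R^-1 * (b - t) ^+ k * y k.+1 i t).
Proof.
move=> dphi; elim: k => [|k IH].
  rewrite (_ : psi 1 i = y 0 i); last first.
    by apply/funext => s; rewrite /psi big_ord1 expr0 fact0 invr1 !mul1r.
  by rewrite expr0 fact0 invr1 !mul1r; exact: is_derive_y.
rewrite (_ : psi k.+2 i = psi k.+1 i +
    (fun s => k.+1`!%:R^-1 * (b - s) ^+ k.+1) * y k.+1 i); last first.
  by apply/funext => s; rewrite /psi big_ord_recr.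
have := is_deriveD IH (is_deriveM (is_derive_weight t k) (is_derive_y k.+1 i dphi)).
by move/is_derive_eq; apply; rewrite /GRing.scale/=; ring.
Qed.

Let psi_left k i :
  psi k i a = (series (exp_term ((b - a) *: A)) k *m phi a) i 0.
Proof.
rewrite /series/= mulmx_suml summxE big_mkord; apply: eq_bigr => j _.
rewrite /exp_term.
have -> : ((b - a) *: A) ^+ j = (b - a) ^+ j *: A ^+ j.
  elim: (j : nat) => [|l IH]; first by rewrite !expr0 scale1r.
  by rewrite !exprS IH -!mulmxE -scalemxAl -scalemxAr scalerA.
by rewrite scalerA -scalemxAl mxE.
Qed.

Let psi_right k i : psi k.+1 i b = phi b i 0.
Proof.
rewrite /psi big_ord_recl big1 ?addr0.
  by rewrite !expr0 fact0 invr1 !mul1r /y expr0 mul1mx.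
by move=> j _; rewrite subrr expr0n/= mulr0 mul0r.
Qed.

(** The mean value theorem for [psi] bounds the distance between [phi b] and a
    partial sum of the series by a multiple of a term of the scalar exponential
    series, which vanishes in the limit. *)
Lemma flow_expmx : a <= b -> {within `[a, b], continuous phi} ->
  (forall t, t \in `]a, b[ -> is_derive t 1 phi (A *m phi t)) ->
  phi b = expmx ((b - a) *: A) *m phi a.
Proof.
move=> ab cphi dphi.
have [c _ phic] : exists2 c, c \in `[a, b] & forall t, t \in `[a, b] -> `|phi t| <= `|phi c|.
  by apply: (@EVT_max _ (fun t => `|phi t|)) => // t; apply: cvg_norm; exact: cphi.
set L := mxrate A; set h := b - a.
have h0 : 0 <= h by rewrite subr_ge0.
have L0 : 0 <= L by exact: mxrate_ge0.
apply/colP => i.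
pose s k := (series (exp_term (h *: A)) k.+1 *m phi a) i 0.
have s_lim : s @ \oo --> (expmx (h *: A) *m phi a) i 0.
  apply: cvg_mx_entry; apply: cvg_mulmx; last exact: cvg_cst.
  rewrite (@cvg_shiftS _ (series (exp_term (h *: A)))).
  exact: cvg_expmx.
suff s_lim' : s @ \oo --> phi b i 0 by rewrite -(cvg_lim _ s_lim)// -(cvg_lim _ s_lim').
have bound k : `|phi b i 0 - s k| <= exp_coeff (h * L) k * (h * L * `|phi c|).
  have cont_psi : {within `[a, b], continuous (psi k.+1 i)}.
    move=> t; apply: cvg_big => [|j _]; first exact: add_continuous.
    apply: cvgM; last by apply: cvg_mx_entry; apply: cvg_mulmx; [exact: cvg_cst|exact: cphi].
    apply: cvgM; first exact: cvg_cst.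
    apply: (continuous_subspaceT (f := fun s : R => (b - s) ^+ j)) => r.
    apply: (@continuous_comp _ _ _ (fun s : R => b - s) (fun u => u ^+ j)); last exact: exprn_continuous.
    by apply: cvgB; [exact: cvg_cst|exact: cvg_id].
  have [|d dab] := @MVT_segment _ (psi k.+1 i)
    (fun t => k`!%:R^-1 * (b - t) ^+ k * y k.+1 i t) a b ab _ cont_psi.
    by move=> t tab; apply: is_derive_psi; exact: dphi.
  rewrite psi_right psi_left -/(s k) -/h => ->.
  have yd : `|y k.+1 i d| <= L ^+ k.+1 * `|phi c|.
    apply: norm_mxpow_mulmx_le => l.
    exact: le_trans (norm_mx_entry_le _ _ _) (phic _ dab).
  have /andP[bd0 bdh] : 0 <= b - d <= h.
    by move: dab; rewrite in_itv/= /h subr_ge0 => /andP[ad ->]; rewrite lerD2l lerN2.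
  rewrite !normrM (ger0_norm h0) normrX (ger0_norm bd0) ger0_norm ?invr_ge0//.
  rewrite (_ : exp_coeff _ _ * _ = k`!%:R^-1 * h ^+ k * (L ^+ k.+1 * `|phi c|) * h); last first.
    by rewrite /exp_coeff/= exprMn exprS; ring.
  rewrite ler_wpM2r// ler_pM// ?mulr_ge0 ?invr_ge0 ?exprn_ge0//.
  by rewrite ler_wpM2l ?invr_ge0// lerXn2r ?nnegrE.
apply/cvgrPdist_le => e e0.
have : exp_coeff (h * L) k * (h * L * `|phi c|) @[k --> \oo] --> 0.
  by rewrite -[0](mul0r (h * L * `|phi c|)); apply: cvgMr_tmp; exact: cvg_exp_coeff.
move=> /cvgrPdist_le /(_ _ e0).
apply: filterS => k; rewrite sub0r normrN; apply: le_trans.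
exact: le_trans (bound k) (ler_norm _).
Qed.
End linear_flow.

(** * The Euclidean norm and quadratic forms *)

Section quadratic_forms.
Context {R : realType} {n : nat}.
Implicit Types (A P Q B : 'M[R]_n) (x y : 'cV[R]_n).

Lemma enorm_ge0 x : 0 <= enorm x.
Proof. exact: sqrtr_ge0. Qed.

Lemma enorm_sqr x : enorm x ^+ 2 = \sum_(i < n) x i 0 ^+ 2.
Proof. by rewrite sqr_sqrtr// sumr_ge0// => i _; exact: sqr_ge0. Qed.

Lemma norm_entry_le_enorm x i : `|x i 0| <= enorm x.
Proof.
rewrite -(@ler_pXn2r _ 2)// ?nnegrE ?enorm_ge0// enorm_sqr real_normK ?num_real//.
by rewrite (bigD1 i)//= lerDl sumr_ge0// => j _; exact: sqr_ge0.
Qed.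

Lemma enorm_le_entries x (c : R) :
  0 <= c -> (forall i, `|x i 0| <= c) -> enorm x <= n%:R * c.
Proof.
move=> c0 xc; have [n0|n0] := posnP n.
  rewrite (_ : enorm x = 0) ?mulr_ge0//.
  by rewrite /enorm big1 ?sqrtr0// => i _; have := ltn_ord i; rewrite {2}n0.
rewrite -(@ler_pXn2r _ 2)// ?nnegrE ?enorm_ge0 ?mulr_ge0// enorm_sqr.
have -> : (n%:R * c) ^+ 2 = \sum_(i < n) n%:R * c ^+ 2.
  by rewrite sumr_const card_ord -mulr_natl; ring.
apply: ler_sum => i _.
apply: (@le_trans _ _ (c ^+ 2)); last by rewrite ler_peMl ?sqr_ge0// ler1n.
by rewrite -[leLHS]real_normK ?num_real// lerXn2r ?nnegrE.
Qed.

Lemma enorm_mulmx_le B x (c : R) : 0 <= c -> (forall i j, `|B i j| <= c) ->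
  enorm (B *m x) <= n%:R ^+ 2 * c * enorm x.
Proof.
move=> c0 Bc.
have -> : n%:R ^+ 2 * c * enorm x = n%:R * (n%:R * c * enorm x) by ring.
apply: enorm_le_entries; first by rewrite !mulr_ge0 ?enorm_ge0.
move=> i; rewrite mxE (le_trans (ler_norm_sum _ _ _))//.
have -> : n%:R * c * enorm x = \sum_(l < n) c * enorm x.
  by rewrite sumr_const card_ord -mulrA mulr_natl.
by apply: ler_sum => l _; rewrite normrM ler_pM// norm_entry_le_enorm.
Qed.

Definition qform P x : R := (x^T *m P *m x) 0 0.

Lemma qform_le_enorm P : exists2 c, 0 <= c & forall x, qform P x <= c * enorm x ^+ 2.
Proof.
exists (\sum_(j < n) \sum_(i < n) `|P i j|).
  by rewrite sumr_ge0// => j _; rewrite sumr_ge0.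
move=> x; rewrite /qform mxE mulr_suml; apply: ler_sum => j _.
rewrite mxE !mulr_suml; apply: ler_sum => i _.
rewrite mxE (le_trans (ler_norm _))// !normrM.
have -> : `|x i 0| * `|P i j| * `|x j 0| = `|P i j| * (`|x i 0| * `|x j 0|) by ring.
by rewrite ler_wpM2l// expr2 ler_pM// norm_entry_le_enorm.
Qed.

Lemma posdef_qform_ge0 P x : posdefmx P -> 0 <= qform P x.
Proof.
move=> [_ Ppos]; have [->|/Ppos/ltW//] := eqVneq x 0.
by rewrite /qform mulmx0 mxE.
Qed.

Lemma posdef_unitmx P : posdefmx P -> P \in unitmx.
Proof.
move=> [PT Ppos]; rewrite -row_free_unit -kermx_eq0; apply/rowV0P => v.
move=> /sub_kermxP vP; apply/eqP; apply: contraT => v0.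
have : v^T != 0 by apply: contra v0 => /eqP/(congr1 trmx); rewrite trmxK trmx0 => ->.
by move=> /Ppos; rewrite trmxK vP mul0mx mxE ltxx.
Qed.

(** The form is nonnegative at [d *: x - q *: y], with [d] its value at [y] and
    [q] the bilinear pairing, and its value there is [d] times the difference of
    the two sides. *)
Lemma posdef_cauchy_schwarz P x y : posdefmx P ->
  ((y^T *m P *m x) 0 0) ^+ 2 <= qform P y * qform P x.
Proof.
move=> [PT Ppos].
have [->|y0] := eqVneq y 0.
  by rewrite /qform trmx0 !mul0mx !mxE expr0n mul0r.
have d0 : 0 < qform P y by exact: Ppos.
set q := (y^T *m P *m x) 0 0; set d := qform P y in d0 *.
have q_sym : (x^T *m P *m y) 0 0 = q.
  transitivity ((y^T *m P *m x)^T 0 0); last by rewrite mxE.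
  by rewrite !trmx_mul trmxK PT mulmxA.
have : 0 <= qform P (d *: x - q *: y) by exact: posdef_qform_ge0.
have -> : qform P (d *: x - q *: y) = d * (d * qform P x - q ^+ 2).
  have tE : (d *: x - q *: y)^T = d *: x^T - q *: y^T.
    by apply/rowP => j; rewrite !mxE.
  rewrite /qform tE !(mulmxBl, mulmxBr) -!(scalemxAl, scalemxAr).
  have entryB (B C : 'M[R]_1) : (B - C) 0 0 = B 0 0 - C 0 0 by rewrite !mxE.
  have entryZ (s : R) (B : 'M[R]_1) : (s *: B) 0 0 = s * B 0 0 by rewrite !mxE.
  rewrite !(entryB, entryZ) q_sym -/q -/(qform P x) -/(qform P y) -/d; ring.
by rewrite pmulr_rge0// subr_ge0.
Qed.

(** The coordinate [x i 0] is the [P]-pairing of [x] with [invmx P *m delta_mx i 0],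
    so Cauchy-Schwarz bounds the squared norm with the trace of the inverse of
    [P] as constant. *)
Lemma posdef_coercive P : posdefmx P ->
  exists2 c, 0 <= c & forall x, enorm x ^+ 2 <= c * qform P x.
Proof.
move=> Ppos; have PU := posdef_unitmx Ppos; have [PT _] := Ppos.
pose e i : 'cV[R]_n := invmx P *m delta_mx i 0.
have eP i : (e i)^T *m P = delta_mx 0 i.
  rewrite /e trmx_mul trmx_inv PT trmx_delta -mulmxA mulVmx// mulmx1//.
exists (\sum_(i < n) qform P (e i)).
  by rewrite sumr_ge0// => i _; exact: posdef_qform_ge0.
move=> x; rewrite enorm_sqr mulr_suml; apply: ler_sum => i _.
apply: le_trans (posdef_cauchy_schwarz x (e i) Ppos).
by rewrite eP -rowE mxE.
Qed.

(** A matrix inequality between quadratic forms is used only through its values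
    along the flow; the exponential of the transpose is the transpose of the
    exponential. *)
Lemma loewner_le_expmx A P Q (s c : R) x :
  loewner_le (expmx (s *: A^T) *m P *m expmx (s *: A)) (c *: Q) ->
  qform P (expmx (s *: A) *m x) <= c * qform Q x.
Proof.
have -> : expmx (s *: A^T) = (expmx (s *: A))^T.
  by rewrite -expmx_tr; congr expmx; apply/matrixP => i j; rewrite !mxE.
move=> [_ /(_ x)]; rewrite mulmxBr mulmxBl -scalemxAr -scalemxAl.
rewrite mxE [X in _ + X]mxE [X in X - _]mxE subr_ge0.
by rewrite /qform trmx_mul !mulmxA.
Qed.

End quadratic_forms.

(** * Switching signals *)

Section switching_signals.
Context {R : realType} {M : nat}.
Variable sigma : R -> 'I_M.
Hypothesis sigma_sig : signals sigma.

(** Read as a real number, the mode is continuous with zero derivative, hence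
    constant by the mean value theorem; at the left end only continuity from the
    right is available, and it suffices. *)
Lemma signal_cst (a b : R) : 0 <= a ->
  (forall s, a < s < b -> ~ switching_instant sigma s) ->
  forall s, a <= s < b -> sigma s = sigma a.
Proof.
move=> a0 nosw c /andP[ac cb]; move: ac; rewrite le_eqVlt => /predU1P[->//|ac].
have near_cst s : a < s < b -> \forall u \near s, sigma u = sigma s.
  move=> /[dup] /nosw + /andP[as_ _]; rewrite /switching_instant.
  by move=> /not_andP[/(_ (le_lt_trans a0 as_))|/contrapT].
pose f s : R := (sigma s : nat)%:R.
have cf : {within `[a, c], continuous f}.
  have near_f s : a < s < b -> \forall u \near s, f u = f s.
    by move=> /near_cst; apply: filterS => u; rewrite /f => ->.
  apply/(continuous_within_itvP _ ac); split.
  - move=> s; rewrite in_itv/= => /andP[as_ sc].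
    by apply: cvg_near_cst; apply: near_f; rewrite as_ (lt_trans sc).
  - apply: cvg_near_cst; have := sigma_sig.2 a a0.
    by apply: filterS => u; rewrite /f => ->.
  - apply: cvg_at_left_filter; apply: cvg_near_cst; apply: near_f.
    by rewrite ac.
have df s : s \in `]a, c[ -> is_derive s 1 f (cst 0 s).
  rewrite in_itv/= => /andP[as_ sc].
  apply: (near_eq_is_derive (f := cst (f s))).
  have : a < s < b by rewrite as_ (lt_trans sc).
  by move=> /near_cst; apply: filterS => u; rewrite /f /= => ->.
have [u _] := MVT ac df cf.
rewrite mul0r => /eqP; rewrite subr_eq0 /f eqr_nat => /eqP.
exact: val_inj.
Qed.

(** By continuity from the right, a signal that has at [b] the mode that it had
    just before is constant around [b]. *)
Lemma switching_neq (a b : R) : switching_instant sigma b ->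
  (forall s, a <= s < b -> sigma s = sigma a) -> a < b -> sigma b != sigma a.
Proof.
move=> [b0 bsw] cst_ab ab; apply/eqP => sba; apply: bsw.
have := sigma_sig.2 b (ltW b0); rewrite near_withinE => right_cst.
near=> s; have [sb|bs|->//] := ltgtP s b.
- rewrite sba; apply: cst_ab; rewrite sb andbT ltW//.
  by near: s; exact: lt_nbhsr.
- exact: (near right_cst s).
Unshelve. all: by end_near. Qed.

(** An increasing sequence below [T] would give infinitely many switching
    instants up to [T]. *)
Lemma switching_times_unbounded (t : nat -> R) (T : R) :
  (forall k, t k < t k.+1) -> (forall k, switching_instant sigma (t k.+1)) ->
  exists k, T < t k.
Proof.
move=> t_incr tsw; apply: contrapT => /forallNP bd.
have : finite_set [set t k.+1 | k in [set: nat]].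
  apply: sub_finite_set (sigma_sig.1 T) => _ [k _ <-]; split; first exact: tsw.
  by rewrite leNgt; apply/negP/bd.
rewrite (eq_finite_set (inj_card_eq _)); first exact: infinite_nat.
by move=> i j _ _ /(inc_inj (Order.NatMonotonyTheory.incnP t_incr)) [].
Qed.

End switching_signals.

(** * Decay along solutions of the switched system *)

Section switched_solution.
Context {R : realType} {n M : nat}.
Variables (A : 'I_M -> 'M[R]_n) (sigma : R -> 'I_M) (x : 'cV[R]_n).
Variable phi : R -> 'cV[R]_n.
Hypothesis phi_sol : is_solution A sigma x phi.

Lemma switched_flow (a b : R) (i : 'I_M) : 0 <= a -> a <= b ->
  (forall s, a < s < b -> ~ switching_instant sigma s) ->
  (forall s, a <= s < b -> sigma s = i) ->
  phi b = expmx ((b - a) *: A i) *m phi a.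
Proof.
have [_ cphi dphi] := phi_sol; move=> a0 ab nosw sigmai; apply: flow_expmx => //.
  apply: continuous_subspaceW cphi => s /=; rewrite !in_itv/= andbT => /andP[as_ _].
  exact: le_trans as_.
move=> s; rewrite in_itv/= => /andP[as_ sb].
rewrite -(sigmai s) ?sb ?andbT ?ltW//.
by apply: dphi; [exact: le_lt_trans as_|apply: nosw; rewrite as_].
Qed.

(** The two matrix inequalities are chained at the intermediate time [b - tau1];
    the first piece has length [b - a - tau1], which lies in
    [0, tau2 - tau1] precisely by the bounds on the duration. *)
Lemma lyapunov_period (rho tau1 tau2 : R) (P Q S : 'M[R]_n) (a b : R)
    (i : 'I_M) :
  0 <= a -> 0 <= tau1 -> tau1 <= b - a <= tau2 ->
  (forall s, a < s < b -> ~ switching_instant sigma s) ->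
  (forall s, a <= s < b -> sigma s = i) ->
  (forall s, 0 <= s <= tau2 - tau1 ->
     loewner_le (expmx (s *: (A i)^T) *m Q *m expmx (s *: A i))
                (expR (- 2 * rho * s) *: P)) ->
  loewner_le (expmx (tau1 *: (A i)^T) *m S *m expmx (tau1 *: A i))
             (expR (- 2 * rho * tau1) *: Q) ->
  qform S (phi b) <= expR (- 2 * rho * (b - a)) * qform P (phi a).
Proof.
move=> a0 tau1_ge0 /andP[dwell1 dwell2] nosw mode flow jump.
pose m := b - tau1.
have am : a <= m by rewrite /m; lra.
have mb : m <= b by rewrite /m; lra.
have flow_am : phi m = expmx ((m - a) *: A i) *m phi a.
  apply: switched_flow => // r /andP[ar rm].
    by apply: nosw; rewrite ar (lt_le_trans rm).
  by apply: mode; rewrite ar (lt_le_trans rm).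
have flow_mb : phi b = expmx (tau1 *: A i) *m phi m.
  rewrite (_ : tau1 = b - m); last by rewrite /m; ring.
  apply: switched_flow => //; first exact: le_trans am.
    by move=> r /andP[mr rb]; apply: nosw; rewrite rb andbT (le_lt_trans am).
  by move=> r /andP[mr rb]; apply: mode; rewrite rb andbT (le_trans am).
have on_mb : qform S (phi b) <= expR (- 2 * rho * tau1) * qform Q (phi m).
  by rewrite flow_mb; exact: loewner_le_expmx jump.
have on_am : qform Q (phi m) <= expR (- 2 * rho * (m - a)) * qform P (phi a).
  rewrite flow_am; apply: loewner_le_expmx; apply: flow.
  by rewrite /m; apply/andP; split; lra.
apply: le_trans on_mb (le_trans (ler_wpM2l (expR_ge0 _) on_am) _).
rewrite mulrA -expRD -mulrDr (_ : tau1 + (m - a) = b - a)//.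
by rewrite /m; ring.
Qed.

End switched_solution.

Lemma increasing_floor (R : realType) (t : nat -> R) (s : R) :
  t 0%N <= s -> (exists k, s < t k) -> exists k, t k <= s < t k.+1.
Proof.
move=> t0 ex; case: (ex_minnP ex) => -[|k] sk kmin; first by rewrite ltNge t0 in sk.
exists k; rewrite sk andbT leNgt; apply/negP => /kmin; rewrite ltnn//.
Qed.

Lemma finite_common_factor (R : realType) (I : finType) (T : Type)
    (f g : I -> T -> R) : (forall i y, 0 <= g i y) ->
  (forall i, exists2 c, 0 <= c & forall y, f i y <= c * g i y) ->
  exists2 c, 0 <= c & forall i y, f i y <= c * g i y.
Proof.
move=> g0 fg.
have /choice[c cP] i : exists c, 0 <= c /\ forall y, f i y <= c * g i y.
  by have [c] := fg i; exists c.
exists (\sum_i c i); first by rewrite sumr_ge0// => i _; exact: (cP i).1.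
move=> i y; apply: le_trans ((cP i).2 y) (ler_wpM2r (g0 i y) _).
by rewrite (bigD1 i)//= lerDl sumr_ge0// => j _; exact: (cP j).1.
Qed.

Theorem corollary2 (R : realType) (n M : nat) (A : 'I_M -> 'M[R]_n)
    (rho tau1 tau2 : R)
    (rho_gt0 : 0 < rho) (tau1_ge0 : 0 <= tau1) (tau12 : tau1 <= tau2)
    (Pp Pm : 'I_M -> 'M[R]_n)
    (Pp_pos : forall i, posdefmx (Pp i)) (Pm_pos : forall i, posdefmx (Pm i))
    (flow_lmi : forall (i : 'I_M) (t : R), 0 <= t <= tau2 - tau1 ->
       loewner_le (expmx (t *: (A i)^T) *m Pp i *m expmx (t *: A i))
                  (expR (- 2 * rho * t) *: Pm i))
    (jump_lmi : forall i j : 'I_M, i != j ->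
       loewner_le (expmx (tau1 *: (A i)^T) *m Pm j *m expmx (tau1 *: A i))
                  (expR (- 2 * rho * tau1) *: Pp i)) :
  UES A rho (dwell_signals tau1 tau2).
Proof.
have [lo lo_ge0 loP] : exists2 lo : R, 0 <= lo &
    forall i y, enorm y ^+ 2 <= lo * qform (Pm i) y.
  apply: finite_common_factor => i; first by move=> y; exact: posdef_qform_ge0.
  exact: posdef_coercive.
have [hi hi_ge0 hiP] : exists2 hi : R, 0 <= hi &
    forall i y, qform (Pm i) y <= hi * enorm y ^+ 2.
  apply: (finite_common_factor (g := fun _ y => enorm y ^+ 2)) => i.
    by move=> y; exact: sqr_ge0.
  exact: qform_le_enorm.
have tau2_ge0 : 0 <= tau2 by exact: le_trans tau12.
pose L := \sum_i mxrate (A i).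
have rateL i : mxrate (A i) <= L.
  by rewrite /L (bigD1 i)//= lerDl sumr_ge0// => j _; exact: mxrate_ge0.
pose G := n%:R ^+ 2 * expR (tau2 * L).
have G0 : 0 <= G by rewrite mulr_ge0 ?exprn_ge0 ?expR_ge0.
(* The factors account for the growth since the last switching instant, for
   the comparison of the forms with the norm, and for the decay that is not yet
   achieved at the last switching instant. *)
exists (G * Num.sqrt (lo * hi) * expR (rho * tau2)).
  by rewrite !mulr_ge0 ?sqrtr_ge0 ?expR_ge0.
move=> sigma [sig [t [t0 t_incr t_sw t_dwell]]] x phi sol s s0.
have tsw k : switching_instant sigma (t k.+1).
  by have : [set s | switching_instant sigma s] (t k.+1) by rewrite -t_sw; exists k.
have t_le := Order.NatMonotonyTheory.incnP t_incr.
have t_ge0 k : 0 <= t k by rewrite -t0 t_le.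
have nosw k r : t k < r < t k.+1 -> ~ switching_instant sigma r.
  move=> /andP[kr rk] rsw.
  have : [set t k.+1 | k in [set: nat]] r by rewrite t_sw.
  move=> [j _ jr]; move: kr rk; rewrite -jr !(leW_mono t_le).
  by rewrite !ltEnat/= => kj jk; have := leq_trans jk kj; rewrite ltnn.
have mode k r : t k <= r < t k.+1 -> sigma r = sigma (t k).
  by apply: (signal_cst sig (t_ge0 k)) => q; exact: nosw.
pose V k := qform (Pm (sigma (t k))) (phi (t k)).
have V_decay k : V k <= expR (- 2 * rho * t k) * V 0%N.
  elim: k => [|k IH]; first by rewrite t0 mulr0 expR0 mul1r.
  have jump : sigma (t k) != sigma (t k.+1).
    by rewrite eq_sym; apply: (switching_neq sig) => // r; exact: mode.
  have step : V k.+1 <= expR (- 2 * rho * (t k.+1 - t k)) * V k.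
    apply: (lyapunov_period sol (t_ge0 k) tau1_ge0 (t_dwell k) (nosw k) (mode k)).
      exact: flow_lmi.
    exact: jump_lmi.
  apply: le_trans step (le_trans (ler_wpM2l (expR_ge0 _) IH) _).
  by rewrite mulrA -expRD -mulrDr subrK.
have [k /andP[ks sk]] : exists k, t k <= s < t k.+1.
  by apply: increasing_floor; [rewrite t0|exact: (switching_times_unbounded sig)].
have enorm_tk : enorm (phi (t k)) <= Num.sqrt (lo * hi) * expR (- rho * t k) * enorm x.
  rewrite -(@ler_pXn2r _ 2)// ?nnegrE ?mulr_ge0 ?enorm_ge0 ?sqrtr_ge0 ?expR_ge0//.
  rewrite !exprMn (sqr_sqrtr (mulr_ge0 lo_ge0 hi_ge0)) -expRM_natl.
  apply: le_trans (loP (sigma (t k)) _) _.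
  have V0 : V 0%N <= hi * enorm x ^+ 2.
    by have [phi0 _ _] := sol; rewrite /V t0 phi0; exact: hiP.
  have := le_trans (V_decay k) (ler_wpM2l (expR_ge0 _) V0).
  move=> /(ler_wpM2l lo_ge0)/le_trans; apply.
  rewrite (_ : - 2 * rho * t k = 2%:R * (- rho * t k)); last by ring.
  by rewrite le_eqVlt; apply/orP; left; apply/eqP; ring.
have flow : phi s = expmx ((s - t k) *: A (sigma (t k))) *m phi (t k).
  apply: (switched_flow sol) => //.
    by move=> r /andP[kr rs]; apply: (nosw k); rewrite kr (lt_trans rs).
  by move=> r /andP[kr rs]; apply: mode; rewrite kr (lt_trans rs).
have sk_tau2 : s - t k <= tau2.
  by have /andP[_ d2] := t_dwell k; lra.
have growth : enorm (phi s) <= G * enorm (phi (t k)).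
  rewrite flow; apply: enorm_mulmx_le; first exact: expR_ge0.
  move=> i j; apply: le_trans (norm_expmx_le _ _ _) _.
  rewrite ler_expR mxrateZ ?subr_ge0// ler_pM ?subr_ge0 ?mxrate_ge0//.
apply: le_trans growth _.
apply: le_trans (ler_wpM2l G0 enorm_tk) _.
have -> : G * Num.sqrt (lo * hi) * expR (rho * tau2) * expR (- rho * s) * enorm x =
  G * (Num.sqrt (lo * hi) * (expR (rho * tau2) * expR (- rho * s)) * enorm x) by ring.
rewrite ler_wpM2l// ler_wpM2r ?enorm_ge0// ler_wpM2l ?sqrtr_ge0//.
rewrite -expRD ler_expR.
have : rho * (s - t k) <= rho * tau2 by rewrite ler_wpM2l// ltW.
lra.
Qed.
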